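(* Let $A$ be a unital Banach algebra and let $a\in A$. Then the following statements hold. (i) $\sigma_{asc}(R_a)\subseteq\sigma_{desc}(L_a)$ and $\sigma_{asc}(L_a)\subseteq\sigma_{desc}(R_a)$. (ii) $\sigma_{\mathcal{DR}}(a)=\sigma_{\mathcal{RD}}(L_a)\cup\sigma_{\mathcal{RD}}(R_a)=\sigma_{desc}(L_a)\cup\sigma_{desc}(R_a)$.
   Context: Banach algebras and Banach spaces are complex. For a Banach space $Y$, $L(Y)$ is the Banach algebra of all bounded linear operators on $Y$; $N(T)$ and $R(T)$ are the null space and range of $T\in L(Y)$. For a unital Banach algebra $A$ with unit $e$ and $a\in A$, the operators $L_a,R_a\in L(A)$ are defined by $L_a(x)=ax$ and $R_a(x)=xa$ for $x\in A$. An element $a\in A$ is Drazin invertible if there exist $b\in A$ and a non-negative integer $m$ such that $a^mba=a^m$, $bab=b$, $ab=ba$ (with $a^0=e$). The Drazin spectrum is $\sigma_{\mathcal{DR}}(a)=\{\lambda\in\mathbb{C}: a-\lambda e\text{ is not Drazin invertible}\}$. For $T\in L(Y)$, the descent is $d(T)=\inf\{n\ge 0: R(T^n)=R(T^{n+1})\}$ and the ascent is $a(T)=\inf\{n\ge 0: N(T^n)=N(T^{n+1})\}$, with $\inf\emptyset=\infty$. The descent spectrum is $\sigma_{desc}(T)=\{\lambda\in\mathbb{C}: d(T-\lambda)=\infty\}$ and the ascent spectrum is $\sigma_{asc}(T)=\{\lambda\in\mathbb{C}: a(T-\lambda)=\infty\}$. The operator $T$ is right Drazin invertible if $d(T)$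 is finite and $R(T^{d(T)})$ is closed; the right Drazin spectrum $\sigma_{\mathcal{RD}}(T)$ is the set of $\lambda\in\mathbb{C}$ such that $T-\lambda$ is not right Drazin invertible. *)

(* Defs.v *)
From HB Require Import structures.
From mathcomp Require Import all_boot all_order all_algebra.
From mathcomp Require Import complex.
From mathcomp Require Import boolp classical_sets functions.
From mathcomp Require Import reals topology normedtype.

Set Implicit Arguments.
Unset Strict Implicit.
Unset Printing Implicit Defensive.

Import Order.TTheory GRing.Theory Num.Theory.

Local Open Scope classical_set_scope.
Local Open Scope ring_scope.

(* A Banach algebra with unit is a [completeNormedModType] with a
   product.  The algebra axioms are listed in the mixin, and the [algType]
   structure is rebuilt from them below, because Hierarchy Builder cannot join
   [CompleteNormedModule] and [GRing.Algebra] (both of which lie below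
   [Num.NumDomain]).  The norm of the unit is not required to be 1. *)
HB.mixin Record CompleteNormedModule_isBanachAlgebra (K : numFieldType) A
    of CompleteNormedModule K A := {
  banach_one : A;
  banach_mul : A -> A -> A;
  banach_mulA : associative banach_mul;
  banach_mul1 : left_id banach_one banach_mul;
  banach_mulr1 : right_id banach_one banach_mul;
  banach_mulDl : left_distributive banach_mul +%R;
  banach_mulDr : right_distributive banach_mul +%R;
  banach_one_neq0 : banach_one != 0;
  banach_scaleAl : forall (l : K) (x y : A),
    l *: banach_mul x y = banach_mul (l *: x) y;
  banach_scaleAr : forall (l : K) (x y : A),
    l *: banach_mul x y = banach_mul x (l *: y);
  banach_normM : forall x y : A, `|banach_mul x y| <= `|x| * `|y|
}.

#[short(type="banachAlgType")]
HB.structure Definition BanachAlgebra (K : numFieldType) :=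
  {A of CompleteNormedModule K A & CompleteNormedModule_isBanachAlgebra K A}.

Section BanachAlgebraIsAlgebra.
Context (K : numFieldType) (A : banachAlgType K).

HB.instance Definition _ := GRing.Zmodule_isNzRing.Build A
  (@banach_mulA K A) (@banach_mul1 K A) (@banach_mulr1 K A)
  (@banach_mulDl K A) (@banach_mulDr K A) (@banach_one_neq0 K A).
HB.instance Definition _ :=
  GRing.Lmodule_isLalgebra.Build K A (@banach_scaleAl K A).
HB.instance Definition _ :=
  GRing.Lalgebra_isAlgebra.Build K A (@banach_scaleAr K A).

Lemma normrM_le (x y : A) : `|x * y| <= `|x| * `|y|.
Proof. exact: banach_normM. Qed.

End BanachAlgebraIsAlgebra.

Definition bounded_op (K : numFieldType) (V W : normedModType K) (f : V -> W) :=
  exists M : K, forall x, `|f x| <= M * `|x|.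

(* L(Y), with [Y] a normed space over [K] *)
Record boundedEnd (K : numFieldType) (Y : normedModType K) := BoundedEnd {
  boundedEnd_linear :> {linear Y -> Y};
  boundedEndP : bounded_op boundedEnd_linear
}.

Section Operators.
Context (K : numFieldType) (Y : normedModType K).
Implicit Types (T : boundedEnd Y) (l : K) (n : nat).

Lemma op_shift_bounded T l :
  bounded_op ((T \- l \*: idfun) : {linear Y -> Y}).
Proof.
have [M TM] := boundedEndP T; exists (M + `|l|) => x /=.
by rewrite mulrDl (le_trans (ler_normB _ _))// normrZ lerD.
Qed.

(* T - l *)
Definition op_shift T l : boundedEnd Y := BoundedEnd (op_shift_bounded T l).

Definition op_range T n : set Y := range (iter n T).
Definition op_null T n : set Y := [set x | iter n T x = 0].

End Operators.

(* The infimum in {0, 1, ..., oo} of a set of natural numbers;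
   [None] stands for oo, the infimum of the empty set. *)
Definition inf_nat (P : set nat) : option nat :=
  match pselect (exists n, `[< P n >]) with
  | left exP => Some (ex_minn exP)
  | right _ => None
  end.

Section Spectra.
Context (K : numFieldType) (Y : normedModType K).
Implicit Types T : boundedEnd Y.

Definition descent T : option nat :=
  inf_nat [set n | op_range T n = op_range T n.+1].

Definition ascent T : option nat :=
  inf_nat [set n | op_null T n = op_null T n.+1].

Definition descent_spectrum T : set K :=
  [set l | descent (op_shift T l) = None].

Definition ascent_spectrum T : set K :=
  [set l | ascent (op_shift T l) = None].

Definition right_Drazin_invertible T : Prop :=
  exists d : nat, descent T = Some d /\ closed (op_range T d).

Definition right_Drazin_spectrum T : set K :=
  [set l | ~ right_Drazin_invertible (op_shift T l)].

End Spectra.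

Section Algebra.
Context (K : numFieldType) (A : banachAlgType K).
Implicit Types a : A.

Definition Drazin_invertible a : Prop :=
  exists (b : A) (m : nat),
    [/\ a ^+ m * b * a = a ^+ m, b * a * b = b & a * b = b * a].

Definition Drazin_spectrum a : set K :=
  [set l | ~ Drazin_invertible (a - l%:A)].

Definition lmul a (x : A) : A := a * x.
Definition rmul a (x : A) : A := x * a.

Fact lmul_is_linear a : linear (lmul a).
Proof. by move=> l x y; rewrite /lmul mulrDr scalerAr. Qed.
HB.instance Definition _ a :=
  GRing.isLinear.Build K A A *:%R (lmul a) (lmul_is_linear a).

Fact rmul_is_linear a : linear (rmul a).
Proof. by move=> l x y; rewrite /rmul mulrDl scalerAl. Qed.
HB.instance Definition _ a :=
  GRing.isLinear.Build K A A *:%R (rmul a) (rmul_is_linear a).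

Fact lmul_bounded a : bounded_op (lmul a).
Proof. by exists `|a| => x; exact: normrM_le. Qed.

Fact rmul_bounded a : bounded_op (rmul a).
Proof. by exists `|a| => x; rewrite mulrC; exact: normrM_le. Qed.

(* the multiplication operators x |-> a x and x |-> x a *)
Definition Lop a : boundedEnd A := @BoundedEnd K A (lmul a) (lmul_bounded a).
Definition Rop a : boundedEnd A := @BoundedEnd K A (rmul a) (rmul_bounded a).

End Algebra.

(* Main.v *)
Require Import Defs.
From mathcomp Require Import all_boot all_order all_algebra.
From mathcomp Require Import complex.
From mathcomp Require Import boolp classical_sets functions.
From mathcomp Require Import reals topology normedtype.

(** The spectra only see the powers of [c = a - l e], since the iterates of
    [L_a - l] and [R_a - l] are multiplication by [c ^+ n] on the left and on
    the right.

    Finite descent of a multiplication operator is an equation in the algebra: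
    evaluating at the unit, the ranges of [L_c ^ n] and [L_c ^ n.+1] agree if
    and only if [c ^+ n = c ^+ n.+1 * y] for some [y]
    ([lmul_descent_equation]), and symmetrically [c ^+ n = z * c ^+ n.+1] on
    the right ([rmul_descent_equation]).  The first equation shows that
    [x * c ^+ n.+1 = 0] forces [x * c ^+ n = 0], which bounds the ascent of
    right multiplication; this is part (i).

    For part (ii), the two equations together are strong pi-regularity of [c].
    Iterating them gives [c ^+ n = c ^+ (2n+1) * Y = Z * c ^+ (2n+1)], and then
    [c ^+ n * Y = Z * c ^+ n] is a Drazin inverse of [c]
    ([Drazin_invertible_of_descent]).  Conversely, if [c] has a Drazin inverse
    [b], then multiplication by [b] is a Drazin inverse of multiplication by
    [c], on either side.  For any bounded operator [T] with a bounded Drazin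
    inverse [S], the ranges of high powers of [T] are all equal to the set of
    fixed points of [T S], which is closed by continuity; hence [T] has
    finite descent and its stable range is closed
    ([right_Drazin_of_Drazin_inverse]).  As right Drazin invertibility contains
    finiteness of the descent, the three conditions on [c] (Drazin
    invertibility, right Drazin invertibility on both sides, and finite descent
    on both sides) coincide. *)

Set Implicit Arguments.
Unset Strict Implicit.
Unset Printing Implicit Defensive.

Import Order.TTheory GRing.Theory Num.Theory.

Local Open Scope classical_set_scope.
Local Open Scope ring_scope.

(** * Ascent, descent and ranges of iterates *)

Lemma inf_nat_SomeP (P : set nat) n : inf_nat P = Some n -> P n.
Proof.
by rewrite /inf_nat; case: pselect => // exP [<-]; case: ex_minnP => m /asboolP.
Qed.

Lemma inf_nat_NoneP (P : set nat) : inf_nat P = None <-> ~ exists n, P n.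
Proof.
rewrite /inf_nat; case: pselect => [exP|nexP]; split=> //.
  by case; case: exP => n /asboolP Pn; exists n.
by move=> _ [n Pn]; apply: nexP; exists n; apply/asboolP.
Qed.

Section Iterates.
Context (K : numFieldType) (Y : normedModType K).
Implicit Types T S : boundedEnd Y.

Lemma descent_NoneP T :
  descent T = None <-> ~ exists n, op_range T n = op_range T n.+1.
Proof. exact: inf_nat_NoneP. Qed.

Lemma ascent_NoneP T :
  ascent T = None <-> ~ exists n, op_null T n = op_null T n.+1.
Proof. exact: inf_nat_NoneP. Qed.

Lemma descent_SomeP T d : descent T = Some d -> op_range T d = op_range T d.+1.
Proof. exact: inf_nat_SomeP. Qed.

Lemma op_range_stable T n k :
  op_range T n = op_range T n.+1 -> op_range T (n + k) = op_range T n.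
Proof.
move=> Tn; elim: k => [|k IHk]; first by rewrite addn0.
have op_rangeS m : op_range T m.+1 = T @` op_range T m.
  by rewrite /op_range image_comp.
by rewrite addnS op_rangeS IHk -op_rangeS.
Qed.

Lemma boundedEnd_continuous T : continuous T.
Proof.
have [M TM] := boundedEndP T.
apply/linear_bounded_continuous/linear_boundedP.
exists `|M|; split=> [|r]; first exact: normr_real.
move=> Mr x; apply: le_trans (TM x) _.
(* [M] need not be nonnegative, not even real, when [Y] is trivial. *)
have /ger0_norm <- : 0 <= M * `|x| by apply: le_trans (TM x).
by rewrite normrM normr_id ler_wpM2r// ltW.
Qed.

Lemma closed_fixed_points T S : closed [set x | T (S x) = x].
Proof.
have -> : [set x | T (S x) = x] = (fun x => T (S x) - x) @^-1` [set 0].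
  by apply/seteqP; split=> x /= => [->|/eqP]; rewrite ?subrr// subr_eq0 => /eqP.
apply: preimage_closed => [x _|].
  apply: cvgB; last exact: cvg_id.
  by apply: continuous_comp; exact: boundedEnd_continuous.
exact/accessible_closed_set1/hausdorff_accessible/norm_hausdorff.
Qed.

(** As [T] and [S] commute, [T S] fixes the range of [T ^ m], hence that of
    [T ^ n]; conversely a fixed point of [T S] is one of [T ^ n S ^ n], hence
    lies in the range of [T ^ n]. *)
Lemma Drazin_inverse_range T S m n :
    (forall x, iter m T (S (T x)) = iter m T x) ->
    (forall x, T (S x) = S (T x)) -> (m <= n)%N ->
  op_range T n = [set x | T (S x) = x].
Proof.
move=> TST TS; have TiterS k x : S (iter k T x) = iter k T (S x).
  by elim: k => //= k IHk; rewrite -TS IHk.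
move=> /subnK <-; set k := (n - m)%N.
apply/seteqP; split=> [_ [x _ <-]|x /= TSx].
  by rewrite /= TiterS -iterS iterSr TS iterD TST -iterD.
have TSn j : iter j T (iter j S x) = x.
  by elim: j => //= j IHj; rewrite -TiterS IHj.
by exists (iter (k + m) S x).
Qed.

(** The descent may be smaller than the exponent [m], but the range at the
    descent already equals the range at higher exponents, which is closed. *)
Lemma right_Drazin_of_Drazin_inverse T S m :
    (forall x, iter m T (S (T x)) = iter m T x) ->
    (forall x, T (S x) = S (T x)) ->
  right_Drazin_invertible T.
Proof.
move=> TST TS; have rangeE n : (m <= n)%N -> _ := Drazin_inverse_range TST TS.
case dT : (descent T) => [d|]; last first.
  by move/descent_NoneP: dT; case; exists m; rewrite !rangeE.
exists d; split=> //; rewrite -(op_range_stable m (descent_SomeP dT)).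
by rewrite rangeE ?leq_addl//; exact: closed_fixed_points.
Qed.

Lemma descent_sub_right_Drazin_spectrum T :
  descent_spectrum T `<=` right_Drazin_spectrum T.
Proof. by move=> l dT [d []]; rewrite dT. Qed.

End Iterates.

(** * Multiplication operators *)

Section Multiplication.
Context (K : numFieldType) (A : banachAlgType K).
Implicit Types (a b c x : A) (l : K).

Lemma iter_lmul_shift a l n x :
  iter n (op_shift (Lop a) l) x = (a - l%:A) ^+ n * x.
Proof.
elim: n => [|n /= ->]; first by rewrite mul1r.
by rewrite exprS -mulrA mulrBl /lmul -scalerAl mul1r.
Qed.

Lemma iter_rmul_shift a l n x :
  iter n (op_shift (Rop a) l) x = x * (a - l%:A) ^+ n.
Proof.
elim: n => [|n /= ->]; first by rewrite mulr1.
by rewrite exprSr mulrA mulrBr /rmul -scalerAr mulr1.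
Qed.

(** The range of [L_c ^ n] is the right ideal generated by [c ^+ n], so
    equality of two of them is tested on the generators. *)
Lemma lmul_descent_equation a l n :
  op_range (op_shift (Lop a) l) n = op_range (op_shift (Lop a) l) n.+1 <->
  exists y, (a - l%:A) ^+ n = (a - l%:A) ^+ n.+1 * y.
Proof.
split=> [rangeE|[y cy]].
  have : op_range (op_shift (Lop a) l) n ((a - l%:A) ^+ n).
    by exists 1 => //; rewrite iter_lmul_shift mulr1.
  by rewrite rangeE => -[y _ <-]; exists y; rewrite iter_lmul_shift.
apply/seteqP; split=> _ [x _ <-].
  by exists (y * x) => //; rewrite !iter_lmul_shift mulrA -cy.
exists ((a - l%:A) * x) => //.
by rewrite !iter_lmul_shift mulrA -exprSr.
Qed.

Lemma rmul_descent_equation a l n :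
  op_range (op_shift (Rop a) l) n = op_range (op_shift (Rop a) l) n.+1 <->
  exists z, (a - l%:A) ^+ n = z * (a - l%:A) ^+ n.+1.
Proof.
split=> [rangeE|[z cz]].
  have : op_range (op_shift (Rop a) l) n ((a - l%:A) ^+ n).
    by exists 1 => //; rewrite iter_rmul_shift mul1r.
  by rewrite rangeE => -[z _ <-]; exists z; rewrite iter_rmul_shift.
apply/seteqP; split=> _ [x _ <-].
  by exists (x * z) => //; rewrite !iter_rmul_shift -mulrA -cz.
exists (x * (a - l%:A)) => //.
by rewrite !iter_rmul_shift -mulrA -exprS.
Qed.

(** If [c ^+ n = c ^+ n.+1 * y], then [x * c ^+ n = (x * c ^+ n.+1) * y]
    vanishes as soon as [x * c ^+ n.+1] does. *)
Lemma rmul_ascent_sub_lmul_descent a :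
  ascent_spectrum (Rop a) `<=` descent_spectrum (Lop a).
Proof.
move=> l /ascent_NoneP ascR; apply/descent_NoneP => -[n].
move=> /lmul_descent_equation[y cy]; apply: ascR; exists n.
apply/seteqP; split=> x; rewrite /op_null /mkset !iter_rmul_shift.
  by rewrite exprSr mulrA => ->; rewrite mul0r.
by rewrite cy mulrA => ->; rewrite mul0r.
Qed.

Lemma lmul_ascent_sub_rmul_descent a :
  ascent_spectrum (Lop a) `<=` descent_spectrum (Rop a).
Proof.
move=> l /ascent_NoneP ascL; apply/descent_NoneP => -[n].
move=> /rmul_descent_equation[z cz]; apply: ascL; exists n.
apply/seteqP; split=> x; rewrite /op_null /mkset !iter_lmul_shift.
  by rewrite exprS -mulrA => ->; rewrite mulr0.
by rewrite cz -mulrA => ->; rewrite mulr0.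
Qed.

Lemma right_power_equation c y n k :
  c ^+ n = c ^+ n.+1 * y -> c ^+ n = c ^+ (n + k) * y ^+ k.
Proof.
move=> cy; elim: k => [|k IHk]; first by rewrite addn0 mulr1.
by rewrite {1}IHk (addnC n) exprD cy mulrA -mulrA -exprD -exprS addnC addSnnS.
Qed.

Lemma left_power_equation c z n k :
  c ^+ n = z * c ^+ n.+1 -> c ^+ n = z ^+ k * c ^+ (n + k).
Proof.
move=> cz; elim: k => [|k IHk]; first by rewrite addn0 mul1r.
by rewrite {1}IHk exprD cz -mulrA mulrA -exprSr -exprD addSnnS.
Qed.

(** Raising both exponents to [N = n + m] and iterating each equation [N.+1]
    times expresses [c ^+ N] through one higher power from either side,
    [c ^+ N = c ^+ (2N+1) * Y = Z * c ^+ (2N+1)], which makes [c ^+ N * Y] an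
    inverse that also has the form [Z * c ^+ N]. *)
Lemma Drazin_invertible_of_descent c m n y z :
  c ^+ m = c ^+ m.+1 * y -> c ^+ n = z * c ^+ n.+1 -> Drazin_invertible c.
Proof.
move=> cy cz; pose N := (n + m)%N.
have {}cy : c ^+ N = c ^+ N.+1 * y.
  by rewrite exprD cy mulrA -exprD addnS.
have {}cz : c ^+ N = z * c ^+ N.+1.
  by rewrite exprD cz -mulrA -exprD addSn.
have := right_power_equation N.+1 cy; have := left_power_equation N.+1 cz.
set Y := y ^+ _; set Z := z ^+ _; set q := c ^+ (N + N.+1) => cZ cY.
have cqN : c * q = c ^+ N.+1 * c ^+ N.+1 by rewrite -exprS -exprD addSn.
have qcN : q * c = c ^+ N.+1 * c ^+ N.+1 by rewrite -exprSr -exprD.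
(* [c ^+ N * Y = Z * q * Y = Z * c ^+ N]: the candidate inverse has two forms,
   whose comparison gives commutation with [c]. *)
have bE : c ^+ N * Y = Z * c ^+ N by rewrite {1}cZ -mulrA -cY.
have cbE : c * (c ^+ N * Y) = c ^+ N * Y * c.
  rewrite [in RHS]bE mulrA -exprS -mulrA -exprSr.
  have cNZ : c ^+ N.+1 = Z * (c ^+ N.+1 * c ^+ N.+1).
    by rewrite -qcN mulrA -cZ exprSr.
  have cNY : c ^+ N.+1 = c ^+ N.+1 * c ^+ N.+1 * Y.
    by rewrite -cqN -mulrA -cY exprS.
  by rewrite {1}cNZ [in RHS]cNY !mulrA.
exists (c ^+ N * Y), N; split=> //.
  by rewrite -mulrA -cbE !mulrA -exprSr -exprD addSnnS -cY.
rewrite {1}bE -(mulrA Z) -exprSr -mulrA (mulrA (c ^+ _)) -exprD addSnnS.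
by rewrite mulrA -cZ.
Qed.

Lemma Drazin_invertible_right_Drazin a l : Drazin_invertible (a - l%:A) ->
  right_Drazin_invertible (op_shift (Lop a) l) /\
  right_Drazin_invertible (op_shift (Rop a) l).
Proof.
set c := a - l%:A => -[b [m [cbc _ cb]]].
have lmulE x : op_shift (Lop a) l x = c * x := iter_lmul_shift a l 1 x.
have rmulE x : op_shift (Rop a) l x = x * c := iter_rmul_shift a l 1 x.
split.
- apply: (@right_Drazin_of_Drazin_inverse _ _ _ (Lop b) m) => x.
    by rewrite !iter_lmul_shift lmulE /= /lmul !mulrA cbc.
  by rewrite !lmulE /= /lmul !mulrA cb.
- apply: (@right_Drazin_of_Drazin_inverse _ _ _ (Rop b) m) => x.
    rewrite !iter_rmul_shift rmulE /= /rmul -!mulrA; congr (_ * _).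
    have cb_comm : GRing.comm (c * b) c by rewrite /GRing.comm -mulrA -cb.
    by rewrite mulrA (commrX m cb_comm) cb mulrA.
  by rewrite !rmulE /= /rmul -!mulrA cb.
Qed.

Lemma Drazin_spectrum_sub_descent a :
  Drazin_spectrum a `<=` descent_spectrum (Lop a) `|` descent_spectrum (Rop a).
Proof.
move=> l nD; apply: contrapT => /not_orP[/descent_NoneP/contrapT[m Lm]].
move=> /descent_NoneP/contrapT[n Rn]; apply: nD.
have [y cy] := (lmul_descent_equation a l m).1 Lm.
have [z cz] := (rmul_descent_equation a l n).1 Rn.
exact: Drazin_invertible_of_descent cy cz.
Qed.

End Multiplication.

Unset Implicit Arguments.

Theorem theorem5 (R : realType) (A : banachAlgType R[i]) (a : A) :
  (ascent_spectrum (Rop a) `<=` descent_spectrum (Lop a) /\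
   ascent_spectrum (Lop a) `<=` descent_spectrum (Rop a)) /\
  (Drazin_spectrum a
     = right_Drazin_spectrum (Lop a) `|` right_Drazin_spectrum (Rop a) /\
   right_Drazin_spectrum (Lop a) `|` right_Drazin_spectrum (Rop a)
     = descent_spectrum (Lop a) `|` descent_spectrum (Rop a)).
Proof.
split.
  split; first exact: rmul_ascent_sub_lmul_descent.
  exact: lmul_ascent_sub_rmul_descent.
have RD_D : right_Drazin_spectrum (Lop a) `|` right_Drazin_spectrum (Rop a)
    `<=` Drazin_spectrum a.
  by move=> l [] nRD /Drazin_invertible_right_Drazin[].
have D_desc := Drazin_spectrum_sub_descent (a := a).
have desc_RD : descent_spectrum (Lop a) `|` descent_spectrum (Rop a)
    `<=` right_Drazin_spectrum (Lop a) `|` right_Drazin_spectrum (Rop a).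
  by apply: setUSS; exact: descent_sub_right_Drazin_spectrum.
by split; apply/seteqP; split=> // l; [move/D_desc/desc_RD | move/RD_D/D_desc].
Qed.
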